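(* Let $\triangle PQR$ be a triangle contained in $D$. If $\delta(P,Q,R)<\Delta'(P,Q)$, then $\frac13<\rho(\psi_{\triangle PQR})<\frac12$. If $\delta(P,Q,R)\ge\Delta'(P,Q)$, then $\rho(\psi_{\triangle PQR})=\frac13$.
   Context: $D$ is the open unit disk in $\mathbb{R}^2$ (Beltrami–Klein model) and $S^1$ its boundary, identified with $\mathbb{R}/\mathbb{Z}$ via $t\mapsto(\cos2\pi t,\sin2\pi t)$; $\pi:\mathbb{R}\to S^1$, $\pi(x)=x-\lfloor x\rfloor$. For $P,Q\in D$ with chord endpoints $v_1,v_2\in S^1$, $d'(P,Q)=\frac12\left|\log\frac{|v_1Q||v_2P|}{|v_1P||v_2Q|}\right|$, $\Delta'(P,Q)=\log\frac{e^{d'(P,Q)}+1}{e^{d'(P,Q)}-1}$, and $\delta(P,Q,R)$ is the minimum of $d'(R,S)$ over points $S\in D$ on the line $PQ$. For a (non-degenerate, closed) triangle $\triangle PQR\subset D$ and $v\in S^1$, there are exactly two chords $vv_1,vv_2$ of $S^1$ whose lines support $\triangle PQR$; with $v_1$ the one reached first moving counterclockwise from $v$, set $\psi_{\triangle PQR}(v):=v_1$ (a homeomorphism of $S^1$). $\overline{\psi_{\triangle PQR}}$ is its lift to $\mathbb{R}$ with $\overline{\psi_{\triangle PQR}}(0)\in(0,1)$, and $\rho(\psi_{\triangle PQR})=\lim_{n\to\infty}\overline{\psi_{\triangle PQR}}^{\,n}(0)/n$ is the rotation number. *)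

(* Defs.v *)
From Stdlib Require Import Reals Lra ClassicalEpsilon.
Open Scope R_scope.

Definition pt := (R * R)%type.

Definition cross (a b c : pt) : R :=
  (fst b - fst a) * (snd c - snd a) - (snd b - snd a) * (fst c - fst a).

Definition dist (a b : pt) : R :=
  sqrt ((fst a - fst b) ^ 2 + (snd a - snd b) ^ 2).

Definition in_D (a : pt) : Prop := fst a ^ 2 + snd a ^ 2 < 1.
Definition on_S1 (a : pt) : Prop := fst a ^ 2 + snd a ^ 2 = 1.

Definition circ (t : R) : pt := (cos (2 * PI * t), sin (2 * PI * t)).

Definition piS1 (x : R) : R := x - IZR (Int_part x).

Definition chord_through (P Q v1 v2 : pt) : Prop :=
  on_S1 v1 /\ on_S1 v2 /\ v1 <> v2 /\ cross v1 v2 P = 0 /\ cross v1 v2 Q = 0.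

Definition dprime (P Q : pt) : R :=
  epsilon (inhabits 0) (fun d => exists v1 v2, chord_through P Q v1 v2 /\
    d = / 2 * Rabs (ln ((dist v1 Q * dist v2 P) / (dist v1 P * dist v2 Q)))).

Definition Deltaprime (P Q : pt) : R :=
  ln ((exp (dprime P Q) + 1) / (exp (dprime P Q) - 1)).

Definition on_line (P Q S : pt) : Prop := cross P Q S = 0.

Definition is_delta (P Q Rv : pt) (m : R) : Prop :=
  (exists S, in_D S /\ on_line P Q S /\ dprime Rv S = m) /\
  (forall S, in_D S -> on_line P Q S -> m <= dprime Rv S).

Definition delta (P Q Rv : pt) : R := epsilon (inhabits 0) (is_delta P Q Rv).

Definition in_triangle (P Q Rv X : pt) : Prop :=
  exists a b c, 0 <= a /\ 0 <= b /\ 0 <= c /\ a + b + c = 1 /\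
    fst X = a * fst P + b * fst Q + c * fst Rv /\
    snd X = a * snd P + b * snd Q + c * snd Rv.

Definition nondegenerate (P Q Rv : pt) : Prop := cross P Q Rv <> 0.

Definition supports (P Q Rv a b : pt) : Prop :=
  a <> b /\
  (exists X, in_triangle P Q Rv X /\ cross a b X = 0) /\
  ((forall X, in_triangle P Q Rv X -> 0 <= cross a b X) \/
   (forall X, in_triangle P Q Rv X -> cross a b X <= 0)).

(* u in [0,1) represents psi(v) for v = circ t: the chord from v to circ u
   supports the triangle, and circ u is the first such endpoint reached
   moving counterclockwise from v (counterclockwise offset piS1 (u - t)) *)
Definition is_psi (P Q Rv : pt) (t u : R) : Prop :=
  0 <= u < 1 /\ piS1 (u - t) <> 0 /\ supports P Q Rv (circ t) (circ u) /\
  (forall u', 0 <= u' < 1 -> piS1 (u' - t) <> 0 ->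
     supports P Q Rv (circ t) (circ u') -> piS1 (u - t) <= piS1 (u' - t)).

(* psi_{PQR} as a map S^1 = [0,1) -> S^1 *)
Definition psi (P Q Rv : pt) (t : R) : R := epsilon (inhabits 0) (is_psi P Q Rv t).

Definition is_lift (P Q Rv : pt) (F : R -> R) : Prop :=
  continuity F /\ (forall x, piS1 (F x) = psi P Q Rv (piS1 x)) /\ 0 < F 0 < 1.

Definition psibar (P Q Rv : pt) : R -> R :=
  epsilon (inhabits (fun x : R => x)) (is_lift P Q Rv).

Definition rho (P Q Rv : pt) : R :=
  epsilon (inhabits 0)
    (fun r => Un_cv (fun n => Nat.iter n (psibar P Q Rv) 0 / INR n) r).

(* Main.v *)
Require Import Defs.
From Stdlib Require Import Reals Lra Lia ClassicalEpsilon.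
From Stdlib Require Import FunctionalExtensionality Nsatz.
From Coquelicot Require Import Coquelicot.
Open Scope R_scope.

(* The lift of the support map is the pointwise minimum [F] of the lifts of the
   half-turns about [P], [Q] and [Rv], acting on the circle at infinity.  Each
   half-turn lift [f] is increasing and satisfies [f (f x) = x + 1]; as no chord
   contains all three points, this forces [F^2 x < x + 1] everywhere and
   [F^3 x > x + 1] somewhere, so the rotation number lies in [[1/3, 1/2)] and
   equals [1/3] exactly when [F^3 x = x + 1] has a solution.  Such a solution is
   an ideal triangle with [P], [Q] and [Rv] on its three sides, that is, a fixed
   point at infinity of the product of the three half-turns.  As a product of
   [2 x 2] matrices it has a real eigenvector iff
     [cross P Q Rv ^ 2 >= (1 - |P|^2) (1 - |Q|^2) (1 - |Rv|^2)],
   which in hyperbolic terms is [sinh d'(P,Q) * sinh delta >= 1]; and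
   [sinh d'(P,Q) * sinh Delta' = 1]. *)

(** * Translation numbers *)

Definition degree_one (F : R -> R) : Prop :=
  (forall x y, x <= y -> F x <= F y) /\ (forall x, F (x + 1) = F x + 1).

Definition translation_number (F : R -> R) (l : R) : Prop :=
  Un_cv (fun n => Nat.iter n F 0 / INR n) l.

Lemma degree_one_IZR F x k : degree_one F -> F (x + IZR k) = F x + IZR k.
Proof.
  intros [_ Fsucc]; induction k as [|k IH|k IH] using Z.peano_ind.
  - now rewrite !Rplus_0_r.
  - now rewrite succ_IZR, <- !Rplus_assoc, Fsucc, IH.
  - rewrite <- Z.sub_1_r, minus_IZR.
    generalize (Fsucc (x + (IZR k - 1))).
    replace (x + (IZR k - 1) + 1) with (x + IZR k) by ring; lra.
Qed.

Lemma degree_one_iter F n : degree_one F -> degree_one (Nat.iter n F).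
Proof.
  intros [Fle Fsucc]; induction n as [|n [IHle IHsucc]]; split; simpl; auto.
  intro x; now rewrite IHsucc, Fsucc.
Qed.

Lemma degree_one_displacement_dist F x :
  degree_one F -> Rabs (F x - x - F 0) <= 1.
Proof.
  intro HF; destruct (base_Int_part x) as [Hfloor Hceil].
  assert (Efloor := degree_one_IZR F 0 (Int_part x) HF).
  assert (Eceil := degree_one_IZR F 0 (Int_part x + 1) HF).
  rewrite plus_IZR in Eceil; destruct HF as [Fle _].
  assert (Hge := Fle (0 + IZR (Int_part x)) x ltac:(lra)).
  assert (Hle := Fle x (0 + (IZR (Int_part x) + 1)) ltac:(lra)).
  apply Rabs_le; lra.
Qed.

Lemma iter_mul (F : R -> R) m n x :
  Nat.iter (n * m) F x = Nat.iter n (Nat.iter m F) x.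
Proof.
  induction n as [|n IH]; [reflexivity|].
  now simpl Nat.mul; rewrite Nat.iter_add, IH.
Qed.

Lemma iter_orbit_dist F n :
  degree_one F -> Rabs (Nat.iter n F 0 - INR n * F 0) <= INR n.
Proof.
  intro HF; induction n as [|n IH].
  - simpl; rewrite Rmult_0_l, Rminus_0_r, Rabs_R0; lra.
  - rewrite S_INR; simpl.
    assert (Hstep := degree_one_displacement_dist F (Nat.iter n F 0) HF).
    apply Rabs_le_between in IH, Hstep; apply Rabs_le; lra.
Qed.

Lemma iter_mean_dist F m n : degree_one F -> (0 < m)%nat -> (0 < n)%nat ->
  Rabs (Nat.iter n F 0 / INR n - Nat.iter m F 0 / INR m) <= / INR n + / INR m.
Proof.
  intros HF Hm Hn; apply lt_0_INR in Hm, Hn.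
  assert (Hnm := iter_orbit_dist (Nat.iter m F) n (degree_one_iter F m HF)).
  assert (Hmn := iter_orbit_dist (Nat.iter n F) m (degree_one_iter F n HF)).
  rewrite <- iter_mul in Hnm, Hmn; rewrite (Nat.mul_comm m n) in Hmn.
  set (a := Nat.iter n F 0) in *; set (b := Nat.iter m F 0) in *.
  apply Rabs_le_between in Hnm, Hmn.
  replace (a / INR n - b / INR m)
    with ((INR m * a - INR n * b) * (/ INR n * / INR m)) by (field; lra).
  replace (/ INR n + / INR m)
    with ((INR m + INR n) * (/ INR n * / INR m)) by (field; lra).
  assert (0 < / INR n * / INR m)
    by (apply Rmult_lt_0_compat; now apply Rinv_0_lt_compat).
  rewrite Rabs_mult, (Rabs_pos_eq (_ * / _)) by lra.
  apply Rmult_le_compat_r; [lra | apply Rabs_le; lra].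
Qed.

Lemma translation_number_exists F :
  degree_one F -> exists l, translation_number F l.
Proof.
  intro HF.
  destruct (Rcomplete.R_complete (fun n => Nat.iter n F 0 / INR n)) as [l Hl];
    [| now exists l].
  intros eps Heps.
  destruct (archimed_cor1 (eps / 2) ltac:(lra)) as [N [HN Npos]].
  assert (HNR := lt_0_INR _ Npos).
  exists N; intros n m Hn Hm; unfold Rdist.
  assert (/ INR n <= / INR N) by (apply Rinv_le_contravar, le_INR; auto).
  assert (/ INR m <= / INR N) by (apply Rinv_le_contravar, le_INR; auto).
  generalize (iter_mean_dist F m n HF ltac:(lia) ltac:(lia)); lra.
Qed.

Lemma Un_cv_bounded_remainder (a : nat -> R) l B :
  (forall n, Rabs (a n - INR n * l) <= B) -> Un_cv (fun n => a n / INR n) l.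
Proof.
  intros Ha eps Heps.
  destruct (INR_archimed eps B Heps) as [N HN].
  exists (S N); intros n Hn; unfold Rdist.
  assert (Hpos : 0 < INR n) by (apply lt_0_INR; lia).
  assert (HNn : INR N <= INR n) by (apply le_INR; lia).
  replace (a n / INR n - l) with ((a n - INR n * l) / INR n) by (field; lra).
  rewrite Rabs_div, (Rabs_pos_eq (INR n)) by lra.
  apply Rmult_lt_reg_r with (INR n); [exact Hpos|].
  replace (Rabs (a n - INR n * l) / INR n * INR n)
    with (Rabs (a n - INR n * l)) by (field; lra).
  specialize (Ha n); nra.
Qed.

Lemma iter_translation_number_dist F l n : degree_one F ->
  translation_number F l -> Rabs (Nat.iter n F 0 - INR n * l) <= 1.
Proof.
  intros HF Hl; destruct n as [|n].
  { simpl; rewrite Rmult_0_l, Rminus_0_r, Rabs_R0; lra. }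
  assert (Hpos : 0 < INR (S n)) by (apply lt_0_INR; lia).
  set (a := Nat.iter (S n) F 0).
  assert (Hmean : Rabs (l - a / INR (S n)) <= / INR (S n)).
  { apply le_epsilon; intros eps Heps.
    destruct (Hl (eps / 2) ltac:(lra)) as [N HN].
    destruct (archimed_cor1 (eps / 2) ltac:(lra)) as [M [HM Mpos]].
    assert (Hclose := HN (N + M)%nat ltac:(lia)); unfold Rdist in Hclose.
    assert (Hdist := iter_mean_dist F (S n) (N + M) HF ltac:(lia) ltac:(lia)).
    assert (/ INR (N + M) <= / INR M)
      by (apply Rinv_le_contravar, le_INR; [apply lt_0_INR|]; lia).
    fold a in Hdist; apply Rabs_lt_between in Hclose.
    apply Rabs_le_between in Hdist; apply Rabs_le; lra. }
  replace (a - INR (S n) * l) with (- (INR (S n) * (l - a / INR (S n))))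
    by (field; lra).
  rewrite Rabs_Ropp, Rabs_mult, Rabs_pos_eq by lra.
  apply Rmult_le_reg_l with (/ INR (S n)); [now apply Rinv_0_lt_compat|].
  rewrite <- Rmult_assoc, Rinv_l by lra; lra.
Qed.

Lemma translation_number_iter F l k : degree_one F ->
  translation_number F l -> translation_number (Nat.iter k F) (INR k * l).
Proof.
  intros HF Hl; apply Un_cv_bounded_remainder with 1; intro n.
  rewrite <- iter_mul, <- Rmult_assoc, <- mult_INR.
  now apply iter_translation_number_dist.
Qed.

Lemma INR_mult_bounded_nonpos a B : (forall n, INR n * a <= B) -> a <= 0.
Proof.
  intro Hbound; apply Rnot_lt_le; intro Ha.
  destruct (INR_archimed a B Ha) as [n Hn]; specialize (Hbound n); lra.
Qed.

Lemma translation_number_between F l a b : degree_one F -> translation_number F l ->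
  (forall x, a <= F x - x <= b) -> a <= l <= b.
Proof.
  intros HF Hl Hab.
  assert (Hiter : forall n, INR n * a <= Nat.iter n F 0 <= INR n * b).
  { induction n as [|n IH]; [simpl; lra|].
    rewrite S_INR; simpl; specialize (Hab (Nat.iter n F 0)); lra. }
  assert (Hdist : forall n, -1 <= Nat.iter n F 0 - INR n * l <= 1)
    by (intro n; now apply Rabs_le_between, iter_translation_number_dist).
  enough (a - l <= 0 /\ l - b <= 0) by lra.
  split; apply INR_mult_bounded_nonpos with 1; intro n;
    specialize (Hiter n); specialize (Hdist n); lra.
Qed.

Lemma translation_number_between_displacements F l :
  degree_one F -> continuity F -> translation_number F l ->
  exists u v, F u - u <= l <= F v - v.
Proof.
  intros HF Fcont Hl.
  assert (Dcont : continuity (fun x => F x - x))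
    by (apply continuity_minus;
        [assumption | apply derivable_continuous, derivable_id]).
  destruct (continuity_ab_min _ 0 1 ltac:(lra) (fun x _ => Dcont x)) as [u [Hu _]].
  destruct (continuity_ab_maj _ 0 1 ltac:(lra) (fun x _ => Dcont x)) as [v [Hv _]].
  exists u, v; apply (translation_number_between F); trivial.
  intro x; destruct (base_Int_part x).
  assert (E := degree_one_IZR F x (- Int_part x) HF); rewrite opp_IZR in E.
  specialize (Hu (x + - IZR (Int_part x)) ltac:(lra)).
  specialize (Hv (x + - IZR (Int_part x)) ltac:(lra)); lra.
Qed.

Lemma translation_number_lt F l c : degree_one F -> continuity F ->
  translation_number F l -> (forall x, F x < x + c) -> l < c.
Proof.
  intros HF Fcont Hl Hc.
  destruct (translation_number_between_displacements F l HF Fcont Hl)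
    as (u & v & Huv).
  specialize (Hc v); lra.
Qed.

Lemma translation_number_gt F l c : degree_one F -> continuity F ->
  translation_number F l -> (forall x, x + c < F x) -> c < l.
Proof.
  intros HF Fcont Hl Hc.
  destruct (translation_number_between_displacements F l HF Fcont Hl)
    as (u & v & Huv).
  specialize (Hc u); lra.
Qed.

Lemma translation_number_of_integer_translate F l x k : degree_one F ->
  translation_number F l -> F x = x + IZR k -> l = IZR k.
Proof.
  intros HF Hl Hx; apply (UL_sequence _ _ _ Hl).
  apply Un_cv_bounded_remainder with 1; intro n.
  assert (Horbit : Nat.iter n F x = x + INR n * IZR k).
  { clear Hl; induction n as [|n IH]; [simpl; ring|].
    rewrite Nat.iter_succ_r, Hx, (degree_one_IZR _ _ _ (degree_one_iter F n HF)),
      IH, S_INR; ring. }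
  assert (Hdist := degree_one_displacement_dist _ x (degree_one_iter F n HF)).
  rewrite Horbit in Hdist; apply Rabs_le_between in Hdist; apply Rabs_le; lra.
Qed.

(** * Half-turn lifts *)

Lemma continuity_zero_between g x y :
  continuity g -> g x <= 0 <= g y -> exists z, g z = 0.
Proof.
  intros Hg Hxy; destruct (IVT_gen g x y 0 Hg) as [z [_ Hz]]; [| now exists z].
  rewrite Rmin_left, Rmax_right; lra.
Qed.

Lemma continuity_iter (F : R -> R) n : continuity F -> continuity (Nat.iter n F).
Proof.
  intro HF; induction n as [|n IH].
  - apply derivable_continuous, derivable_id.
  - exact (continuity_comp (Nat.iter n F) F IH HF).
Qed.

Lemma continuity_Rmin f g : continuity f -> continuity g ->
  continuity (fun x => Rmin (f x) (g x)).
Proof.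
  intros Hf Hg x.
  apply continuity_pt_ext with (fun y => (f y + g y - Rabs (f y - g y)) * / 2).
  { intro y; unfold Rmin; destruct (Rle_dec (f y) (g y));
      [rewrite Rabs_left1 by lra | rewrite Rabs_pos_eq by lra]; field. }
  apply (continuity_mult (fun y => f y + g y - Rabs (f y - g y)) (fun _ => / 2));
    [| apply continuity_const; now intros ? ?].
  apply continuity_minus; [now apply continuity_plus|].
  apply (continuity_comp (fun y => f y - g y) Rabs);
    [now apply continuity_minus | apply Rcontinuity_abs].
Qed.

Record half_turn_lift (f : R -> R) : Prop := {
  half_turn_lift_continuity : continuity f;
  half_turn_lift_increasing : forall x y, x < y -> f x < f y;
  half_turn_lift_square : forall x, f (f x) = x + 1 }.

Arguments half_turn_lift_continuity {f}.
Arguments half_turn_lift_increasing {f}.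
Arguments half_turn_lift_square {f}.

Lemma half_turn_lift_le {f} (Hf : half_turn_lift f) x y : x <= y -> f x <= f y.
Proof.
  intros [Hlt | ->]; [left; now apply half_turn_lift_increasing | apply Rle_refl].
Qed.

Lemma half_turn_lift_succ {f} (Hf : half_turn_lift f) x : f (x + 1) = f x + 1.
Proof. now rewrite <- !(half_turn_lift_square Hf). Qed.

Lemma half_turn_lift_gt {f} (Hf : half_turn_lift f) x : x < f x.
Proof.
  apply Rnot_le_lt; intro Hle; apply (half_turn_lift_le Hf) in Hle as Hle2.
  rewrite (half_turn_lift_square Hf) in Hle2; lra.
Qed.

Lemma half_turn_lift_lt_iff {f} (Hf : half_turn_lift f) x y : f x < f y <-> x < y.
Proof.
  split; [| apply (half_turn_lift_increasing Hf)].
  intro Hlt; apply Rnot_le_lt; intro Hle.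
  apply (half_turn_lift_le Hf) in Hle; lra.
Qed.

Lemma half_turn_lift_lt_adjoint {f} (Hf : half_turn_lift f) x y :
  f x < y <-> x + 1 < f y.
Proof.
  rewrite <- (half_turn_lift_square Hf x); symmetry.
  apply (half_turn_lift_lt_iff Hf).
Qed.

Lemma half_turn_lift_gt_adjoint {f} (Hf : half_turn_lift f) x y :
  y < f x <-> f y < x + 1.
Proof.
  rewrite <- (half_turn_lift_square Hf x); symmetry.
  apply (half_turn_lift_lt_iff Hf).
Qed.

Lemma half_turn_lift_eq_adjoint {f} (Hf : half_turn_lift f) x y :
  f x = y <-> f y = x + 1.
Proof.
  split; [intros <-; apply (half_turn_lift_square Hf)|].
  generalize (half_turn_lift_lt_adjoint Hf x y) (half_turn_lift_gt_adjoint Hf x y).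
  intros Hlt Hgt E; destruct (Rtotal_order (f x) y) as [H | [H | H]]; [| easy |].
  - apply Hlt in H; lra.
  - apply Hgt in H; lra.
Qed.

(* As [p] is its own inverse up to a turn, [p - q] changes sign between [0] and
   [p 0]. *)
Lemma half_turn_lifts_meet {p q} (Hp : half_turn_lift p) (Hq : half_turn_lift q) :
  exists x, p x = q x.
Proof.
  assert (Hcont : continuity (fun x => p x - q x))
    by (apply continuity_minus; now apply half_turn_lift_continuity).
  enough (exists x, p x - q x = 0) as [x Hx] by (exists x; lra).
  destruct (Rle_lt_dec (p 0) (q 0)) as [[Hlt | Heq] | Hlt].
  - apply (half_turn_lift_gt_adjoint Hq) in Hlt as Hlt1.
    apply (continuity_zero_between _ 0 (p 0) Hcont).
    rewrite (half_turn_lift_square Hp); lra.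
  - exists 0; lra.
  - apply (half_turn_lift_gt_adjoint Hp) in Hlt as Hlt1.
    apply (continuity_zero_between _ (q 0) 0 Hcont).
    rewrite (half_turn_lift_square Hq); lra.
Qed.

Definition pointwise_min (fs : (R -> R) -> Prop) (F : R -> R) : Prop :=
  forall x, (forall f, fs f -> F x <= f x) /\ exists f, fs f /\ F x = f x.

Section PointwiseMin.

Variables (fs : (R -> R) -> Prop) (F : R -> R).
Hypothesis fs_lifts : forall f, fs f -> half_turn_lift f.
Hypothesis F_min : pointwise_min fs F.

Lemma pointwise_min_le x f : fs f -> F x <= f x.
Proof. apply (F_min x). Qed.

Lemma pointwise_min_attained x : exists f, fs f /\ half_turn_lift f /\ F x = f x.
Proof. destruct (F_min x) as [_ (f & Hf & E)]; eauto. Qed.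

Lemma pointwise_min_gt x : x < F x.
Proof.
  destruct (pointwise_min_attained x) as (f & _ & Hf & ->).
  now apply half_turn_lift_gt.
Qed.

Lemma pointwise_min_increasing x y : x < y -> F x < F y.
Proof.
  intro Hxy; destruct (pointwise_min_attained y) as (f & fs_f & Hf & ->).
  apply Rle_lt_trans with (f x); [now apply pointwise_min_le|].
  now apply half_turn_lift_increasing.
Qed.

Lemma pointwise_min_degree_one : degree_one F.
Proof.
  split.
  - intros x y [Hlt | ->]; [left; now apply pointwise_min_increasing | lra].
  - intro x; apply Rle_antisym.
    + destruct (pointwise_min_attained x) as (f & fs_f & Hf & ->).
      rewrite <- (half_turn_lift_succ Hf); now apply pointwise_min_le.
    + destruct (pointwise_min_attained (x + 1)) as (f & fs_f & Hf & ->).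
      rewrite (half_turn_lift_succ Hf).
      now apply Rplus_le_compat_r, pointwise_min_le.
Qed.

Lemma pointwise_min_iter2_lt x : (exists f, fs f /\ F x < f x) -> F (F x) < x + 1.
Proof.
  intros (f & fs_f & Hlt).
  apply Rle_lt_trans with (f (F x)); [now apply pointwise_min_le|].
  now apply (half_turn_lift_gt_adjoint (fs_lifts f fs_f)).
Qed.

Lemma pointwise_min_iter3_distinct x :
  (forall y, exists f, fs f /\ F y < f y) -> F (F (F x)) = x + 1 ->
  exists f g h, fs f /\ fs g /\ fs h /\ f <> g /\ g <> h /\ h <> f /\
    h (g (f x)) = x + 1.
Proof.
  intros Hbelow E.
  destruct (pointwise_min_attained x) as (f & fs_f & Hf & Ef).
  destruct (pointwise_min_attained (F x)) as (g & fs_g & Hg & Eg).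
  destruct (pointwise_min_attained (F (F x))) as (h & fs_h & Hh & Eh).
  exists f, g, h; repeat split; try assumption; try congruence.
  - intros <-; generalize (pointwise_min_iter2_lt x (Hbelow x)).
    rewrite Eg, Ef, (half_turn_lift_square Hf); lra.
  - intros <-; generalize (pointwise_min_iter2_lt (F x) (Hbelow (F x))).
    rewrite Eh, Eg, (half_turn_lift_square Hg); lra.
  - intros ->; rewrite E in Eh; symmetry in Eh.
    apply (half_turn_lift_eq_adjoint Hf) in Eh.
    generalize (pointwise_min_gt (F x)); lra.
Qed.

End PointwiseMin.

Definition among3 {A : Type} (a b c x : A) : Prop := x = a \/ x = b \/ x = c.

Lemma among3_forall {A : Type} (pred : A -> Prop) a b c :
  pred a -> pred b -> pred c -> forall x, among3 a b c x -> pred x.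
Proof. now intros Ha Hb Hc x [-> | [-> | ->]]. Qed.

Lemma among3_map {A B : Type} (m : A -> B) a b c y :
  among3 (m a) (m b) (m c) y <-> exists x, among3 a b c x /\ y = m x.
Proof. unfold among3; firstorder (subst; eauto). Qed.

Definition min3 (p q r : R -> R) (x : R) : R := Rmin (p x) (Rmin (q x) (r x)).

Lemma min3_pointwise_min p q r : pointwise_min (among3 p q r) (min3 p q r).
Proof.
  intro x; unfold min3; split.
  - generalize (Rmin_l (p x) (Rmin (q x) (r x))) (Rmin_r (p x) (Rmin (q x) (r x)))
      (Rmin_l (q x) (r x)) (Rmin_r (q x) (r x)).
    intros ? ? ? ? f [-> | [-> | ->]]; lra.
  - unfold among3, Rmin at 1 2.
    destruct (Rle_dec (q x) (r x)), (Rle_dec (p x) _); eauto.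
Qed.

Lemma min3_rotate p q r x : min3 p q r x = min3 q r p x.
Proof. unfold min3; now rewrite Rmin_comm, Rmin_assoc. Qed.

Lemma min3_reverse p q r x : min3 p q r x = min3 r q p x.
Proof.
  unfold min3; now rewrite (Rmin_comm (q x) (p x)), Rmin_assoc, Rmin_comm.
Qed.

Section MinOfThree.

Variables p q r : R -> R.
Hypothesis Hp : half_turn_lift p.
Hypothesis Hq : half_turn_lift q.
Hypothesis Hr : half_turn_lift r.

Let F := min3 p q r.

Lemma min3_continuity : continuity F.
Proof. repeat apply continuity_Rmin; now apply half_turn_lift_continuity. Qed.

Lemma min3_degree_one : degree_one F.
Proof.
  exact (pointwise_min_degree_one _ _ (among3_forall _ _ _ _ Hp Hq Hr)
           (min3_pointwise_min p q r)).
Qed.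

Lemma translation_number_min3_eq_third l : translation_number F l ->
  (exists x, F (F (F x)) = x + 1) -> l = 1 / 3.
Proof.
  intros Hl [x Hx].
  assert (HF := min3_degree_one).
  assert (E := translation_number_of_integer_translate _ _ x 1
                 (degree_one_iter F 3 HF) (translation_number_iter F l 3 HF Hl) Hx).
  simpl INR in E; lra.
Qed.

Lemma min3_cycle_step x : r (q (p x)) = x + 1 -> F x = p x.
Proof.
  intro E; apply (half_turn_lift_eq_adjoint Hr) in E as Er.
  assert (Hpr : p x < r x) by (rewrite Er; now apply half_turn_lift_gt).
  assert (Hpq : p x < q x).
  { apply (half_turn_lift_gt_adjoint Hq); rewrite <- E.
    now apply half_turn_lift_gt. }
  unfold F, min3; rewrite Rmin_left; [reflexivity|].
  apply Rmin_glb; lra.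
Qed.

End MinOfThree.

Lemma min3_iter3_of_cycle p q r x :
  half_turn_lift p -> half_turn_lift q -> half_turn_lift r ->
  r (q (p x)) = x + 1 -> min3 p q r (min3 p q r (min3 p q r x)) = x + 1.
Proof.
  intros Hp Hq Hr E.
  assert (Ep : p (r (q (p x))) = p x + 1) by now rewrite E, half_turn_lift_succ.
  assert (Eq : q (p (r (q (p x)))) = q (p x) + 1)
    by now rewrite Ep, half_turn_lift_succ.
  rewrite (min3_cycle_step p q r Hq Hr x E).
  rewrite (min3_rotate p q r (p x)), (min3_cycle_step q r p Hr Hp (p x) Ep).
  rewrite (min3_rotate p q r), (min3_rotate q r p).
  now rewrite (min3_cycle_step r p q Hp Hq (q (p x)) Eq).
Qed.

Lemma half_turn_lift_cycle_reverse p q r x :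
  half_turn_lift p -> half_turn_lift q -> half_turn_lift r ->
  r (q (p x)) = x + 2 -> p (q (r x)) = x + 1.
Proof.
  intros Hp Hq Hr E.
  assert (Er : q (p x) = r x + 1).
  { rewrite <- (half_turn_lift_succ Hr).
    symmetry; apply (half_turn_lift_eq_adjoint Hr); lra. }
  apply (half_turn_lift_eq_adjoint Hq (r x) (p x)) in Er.
  rewrite Er; apply (half_turn_lift_square Hp).
Qed.

Section NoncoincidentMinOfThree.

Variables p q r : R -> R.
Hypothesis Hp : half_turn_lift p.
Hypothesis Hq : half_turn_lift q.
Hypothesis Hr : half_turn_lift r.
Hypothesis noncoincident : forall x, ~ (p x = q x /\ q x = r x).

Let F := min3 p q r.

Lemma min3_lt_some x : exists f, among3 p q r f /\ F x < f x.
Proof.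
  destruct (min3_pointwise_min p q r x) as [Hle _]; fold F in Hle.
  assert (Fp : F x <= p x) by (apply Hle; red; auto).
  assert (Fq : F x <= q x) by (apply Hle; red; auto).
  assert (Fr : F x <= r x) by (apply Hle; red; auto).
  unfold among3; destruct Fp as [Fp | Fp]; [eauto|].
  destruct Fq as [Fq | Fq]; [eauto|].
  destruct Fr as [Fr | Fr]; [eauto|].
  now destruct (noncoincident x); split; rewrite <- Fq.
Qed.

Lemma min3_iter2_lt x : F (F x) < x + 1.
Proof.
  apply (pointwise_min_iter2_lt (among3 p q r)); [| | apply min3_lt_some].
  - now apply among3_forall.
  - apply min3_pointwise_min.
Qed.

Lemma half_turn_lifts_meet_below : exists x, p x = q x /\ p x < r x.
Proof.
  destruct (half_turn_lifts_meet Hp Hq) as [x E].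
  destruct (Rtotal_order (p x) (r x)) as [Hlt | [Heq | Hgt]].
  - now exists x.
  - now destruct (noncoincident x); split; [| rewrite <- E].
  - exists (p x); split.
    + now rewrite (half_turn_lift_square Hp), E, (half_turn_lift_square Hq).
    + rewrite (half_turn_lift_square Hp).
      now apply (half_turn_lift_lt_adjoint Hr).
Qed.

Lemma min3_iter3_gt_somewhere : exists x, x + 1 < F (F (F x)).
Proof.
  destruct half_turn_lifts_meet_below as (x & E & Hlt); exists x.
  assert (Fx : F x = p x)
    by (unfold F, min3; rewrite <- E, (Rmin_left (p x) (r x)), Rmin_left; lra).
  set (y := p x) in *.
  assert (Ep : p y = x + 1) by apply (half_turn_lift_square Hp).
  assert (Eq : q y = x + 1) by (rewrite E; apply (half_turn_lift_square Hq)).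
  apply (half_turn_lift_gt_adjoint Hr) in Hlt as Hry.
  assert (Fy : F y = r y)
    by (unfold F, min3; rewrite Ep, Eq, !(Rmin_right (x + 1) (r y)); lra).
  rewrite Fx, Fy; unfold F, min3; repeat apply Rmin_glb_lt.
  - rewrite <- Ep; now apply half_turn_lift_increasing, half_turn_lift_gt.
  - rewrite <- Eq; now apply half_turn_lift_increasing, half_turn_lift_gt.
  - rewrite (half_turn_lift_square Hr).
    now apply Rplus_lt_compat_r, half_turn_lift_gt.
Qed.

Lemma min3_iter3_gt :
  (forall x, F (F (F x)) <> x + 1) -> forall x, x + 1 < F (F (F x)).
Proof.
  intros Hne x; destruct min3_iter3_gt_somewhere as [y Hy].
  apply Rnot_le_lt; intro Hx.
  destruct (continuity_zero_between (fun z => Nat.iter 3 F z - (z + 1)) x y)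
    as [z Hz]; [| simpl; lra | apply (Hne z); simpl in Hz; lra].
  apply continuity_minus; [now apply continuity_iter, min3_continuity|].
  apply continuity_plus; [apply derivable_continuous, derivable_id|].
  apply continuity_const; now intros ? ?.
Qed.

Lemma translation_number_min3_between l : translation_number F l ->
  (forall x, F (F (F x)) <> x + 1) -> 1 / 3 < l < 1 / 2.
Proof.
  intros Hl Hne.
  assert (HF : degree_one F) by now apply min3_degree_one.
  assert (Fcont : continuity F) by now apply min3_continuity.
  assert (Hgt := translation_number_gt _ _ 1 (degree_one_iter F 3 HF)
    (continuity_iter F 3 Fcont) (translation_number_iter F l 3 HF Hl)
    (min3_iter3_gt Hne)).
  assert (Hlt := translation_number_lt _ _ 1 (degree_one_iter F 2 HF)
    (continuity_iter F 2 Fcont) (translation_number_iter F l 2 HF Hl)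
    min3_iter2_lt).
  simpl INR in Hgt, Hlt; lra.
Qed.

End NoncoincidentMinOfThree.

(** * Half-turns acting on the circle *)

(* The Minkowski form of the homogeneous vectors [(X, 1)] and [(Y, 1)]. *)
Definition mink (X Y : pt) : R := 1 - fst X * fst Y - snd X * snd Y.

Definition wedge (a b : pt) : R := fst a * snd b - snd a * fst b.

Definition scale (k : R) (a : pt) : pt := (k * fst a, k * snd a).

Definition ray (t : R) : pt := (cos (PI * t), sin (PI * t)).

(* By the inscribed angle theorem the chord from [circ t] through [X] ends at
   [circ (half_turn X t)]: the quotient is the tangent of the angle at [circ t]
   from the inner normal to [X]. *)
Definition half_turn (X : pt) (t : R) : R :=
  t + 1 / 2 - atan (wedge (circ t) X / mink X (circ t)) / PI.

(* In the rational parametrization of the circle by half-angles, the half-turn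
   about [X] is the traceless matrix [[-y, x + 1], [x - 1, y]]. *)
Definition act (X a : pt) : pt :=
  ((fst X + 1) * snd a - snd X * fst a, (fst X - 1) * fst a + snd X * snd a).

Lemma sin_PI_mul_pos z : 0 < z < 1 -> 0 < sin (PI * z).
Proof. intro Hz; assert (HPI := PI_RGT_0); apply sin_gt_0; nra. Qed.

Lemma sin_PI_mul_IZR k : sin (PI * IZR k) = 0.
Proof. apply sin_eq_0_1; exists k; ring. Qed.

Lemma sin_PI_mul_eq0 z : sin (PI * z) = 0 -> exists k : Z, z = IZR k.
Proof.
  intro H; destruct (sin_eq_0_0 _ H) as [k Hk]; exists k.
  apply Rmult_eq_reg_l with PI; [lra | apply PI_neq0].
Qed.

Lemma polar_atan m w : m <> 0 ->
  exists k, 0 < k * m /\ m = k * cos (atan (w / m)) /\ w = k * sin (atan (w / m)).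
Proof.
  intro Hm; set (u := atan (w / m)).
  assert (Hcos : 0 < cos u)
    by (destruct (atan_bound (w / m)); apply cos_gt_0; unfold u; lra).
  assert (Htan : sin u / cos u = w / m) by exact (tan_atan (w / m)).
  exists (m / cos u); split; [| split].
  - replace (m / cos u * m) with (m ^ 2 / cos u) by (field; lra).
    apply Rdiv_lt_0_compat; [now apply pow2_gt_0 | exact Hcos].
  - field; lra.
  - transitivity (m * (sin u / cos u)); [rewrite Htan; now field | field; lra].
Qed.

Lemma ray_neq0 t : ray t <> (0, 0).
Proof. intro E; injection E; intros; now apply (cos_sin_0 (PI * t)). Qed.

Lemma ray_exists a : a <> (0, 0) -> exists k t, k <> 0 /\ a = scale k (ray t).
Proof.
  destruct a as [x y]; intro Ha; destruct (Req_dec x 0) as [-> | Hx].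
  - exists y, (1 / 2); split; [now intros -> |].
    unfold scale, ray; simpl; replace (PI * (1 / 2)) with (PI / 2) by field.
    rewrite cos_PI2, sin_PI2; f_equal; ring.
  - destruct (polar_atan x y Hx) as (k & Hk & Ex & Ey).
    exists k, (atan (y / x) / PI); split; [nra|].
    unfold scale, ray; simpl.
    replace (PI * (atan (y / x) / PI)) with (atan (y / x))
      by (field; apply PI_neq0).
    now rewrite <- Ex, <- Ey.
Qed.

Lemma circ_ray t : circ t =
  (fst (ray t) ^ 2 - snd (ray t) ^ 2, 2 * snd (ray t) * fst (ray t)).
Proof.
  unfold circ, ray; rewrite Rmult_assoc, cos_2a, sin_2a; f_equal; simpl; ring.
Qed.

Lemma circ_on_S1 t : on_S1 (circ t).
Proof.
  unfold on_S1, circ; simpl fst; simpl snd.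
  generalize (sin2_cos2 (2 * PI * t)); unfold Rsqr; lra.
Qed.

Lemma wedge_ray t u : wedge (ray t) (ray u) = sin (PI * (u - t)).
Proof. unfold wedge, ray; simpl; rewrite Rmult_minus_distr_l, sin_minus; ring. Qed.

Lemma wedge_diag a : wedge a a = 0.
Proof. unfold wedge; ring. Qed.

Lemma wedge_scale_l k a b : wedge (scale k a) b = k * wedge a b.
Proof. unfold wedge, scale; simpl; ring. Qed.

Lemma wedge_scale_r k a b : wedge a (scale k b) = k * wedge a b.
Proof. unfold wedge, scale; simpl; ring. Qed.

Lemma scale_scale k l a : scale k (scale l a) = scale (k * l) a.
Proof. unfold scale; simpl; f_equal; ring. Qed.

Lemma act_scale X k a : act X (scale k a) = scale k (act X a).
Proof. unfold act, scale; simpl; f_equal; ring. Qed.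

Lemma act_act X a : act X (act X a) = scale (- mink X X) a.
Proof. destruct a; unfold act, scale, mink; simpl; f_equal; ring. Qed.

Lemma wedge_act X a b : wedge (act X a) (act X b) = mink X X * wedge a b.
Proof. unfold wedge, act, mink; simpl; ring. Qed.

Lemma mink_sym X Y : mink X Y = mink Y X.
Proof. unfold mink; ring. Qed.

Lemma mink_diag_pos X : in_D X <-> 0 < mink X X.
Proof. unfold in_D, mink; lra. Qed.

Lemma mink_on_S1 X : on_S1 X -> mink X X = 0.
Proof. unfold on_S1, mink; lra. Qed.

Lemma mink_on_S1_pos X Y : in_D X -> on_S1 Y -> 0 < mink X Y.
Proof.
  destruct X as [a b], Y as [c d]; unfold in_D, on_S1, mink; simpl fst; simpl snd.
  intros HX HY.
  assert (E : (a * c + b * d) ^ 2 + (a * d - b * c) ^ 2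
              = (a ^ 2 + b ^ 2) * (c ^ 2 + d ^ 2)) by ring.
  generalize (pow2_ge_0 (a * d - b * c)); intro; rewrite HY in E; nra.
Qed.

Lemma act_ray_coords X t : act X (ray t) =
  (mink X (circ t) * sin (PI * t) - wedge (circ t) X * cos (PI * t),
   - (mink X (circ t) * cos (PI * t) + wedge (circ t) X * sin (PI * t))).
Proof.
  rewrite circ_ray; unfold act, mink, wedge, ray; simpl fst; simpl snd.
  assert (E := sin2_cos2 (PI * t)); unfold Rsqr in E; f_equal; nsatz.
Qed.

Lemma act_ray X t : in_D X ->
  exists k, 0 < k /\ act X (ray t) = scale (- k) (ray (half_turn X t)).
Proof.
  intro HX; assert (Hmink := mink_on_S1_pos X (circ t) HX (circ_on_S1 t)).
  destruct (polar_atan (mink X (circ t)) (wedge (circ t) X) ltac:(lra))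
    as (k & Hk & Emink & Ewedge).
  exists k; split; [nra|].
  set (u := atan _) in *; rewrite act_ray_coords, Emink, Ewedge.
  unfold scale, ray, half_turn; fold u.
  replace (PI * (t + 1 / 2 - u / PI)) with (PI / 2 + (PI * t - u))
    by (field; apply PI_neq0).
  rewrite <- cos_sin, cos_plus, cos_PI2, sin_PI2, sin_minus, cos_minus.
  simpl; f_equal; ring.
Qed.

Lemma half_turn_bounds X t : t < half_turn X t < t + 1.
Proof.
  unfold half_turn; assert (HPI := PI_RGT_0).
  destruct (atan_bound (wedge (circ t) X / mink X (circ t))) as [Hlo Hhi].
  set (u := atan _) in *.
  assert (E : u = u / PI * PI) by (field; lra); nra.
Qed.

Lemma half_turn_square X t : in_D X -> half_turn X (half_turn X t) = t + 1.
Proof.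
  intro HX; destruct (act_ray X t HX) as (k & Hk & Ek).
  destruct (act_ray X (half_turn X t) HX) as (l & Hl & El).
  assert (E : wedge (ray t) (act X (act X (ray t))) = 0)
    by (rewrite act_act, wedge_scale_r, wedge_diag; ring).
  rewrite Ek, act_scale, El, !wedge_scale_r, wedge_ray in E.
  destruct (sin_PI_mul_eq0 (half_turn X (half_turn X t) - t)) as [n Hn].
  { apply Rmult_eq_reg_l with (k * l); [lra | nra]. }
  generalize (half_turn_bounds X t) (half_turn_bounds X (half_turn X t)); intros.
  assert (0 < n < 2)%Z by (split; apply lt_IZR; lra).
  replace n with 1%Z in Hn by lia; lra.
Qed.

(* The matrix of a half-turn has the positive determinant [mink X X], so it
   preserves the cyclic order of rays. *)
Lemma half_turn_increasing X t u : in_D X -> t < u -> half_turn X t < half_turn X u.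
Proof.
  intros HX Htu; generalize (half_turn_bounds X t) (half_turn_bounds X u); intros.
  destruct (Rle_lt_dec (t + 1) u); [lra|].
  destruct (act_ray X t HX) as (k & Hk & Ek), (act_ray X u HX) as (l & Hl & El).
  assert (E := wedge_act X (ray t) (ray u)).
  rewrite Ek, El, wedge_scale_l, wedge_scale_r, !wedge_ray in E.
  assert (Hpos : 0 < mink X X * sin (PI * (u - t)))
    by (apply Rmult_lt_0_compat;
        [now apply mink_diag_pos | apply sin_PI_mul_pos; lra]).
  assert (Hsin : 0 < sin (PI * (half_turn X u - half_turn X t)))
    by (apply Rmult_lt_reg_l with (k * l); [nra | lra]).
  apply Rnot_le_lt; intros [Hlt | Heq].
  - assert (Hneg : 0 < sin (PI * (half_turn X t - half_turn X u)))
      by (apply sin_PI_mul_pos; lra).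
    rewrite <- Ropp_minus_distr, <- Ropp_mult_distr_r, sin_neg in Hneg; lra.
  - rewrite Heq, Rminus_diag, Rmult_0_r, sin_0 in Hsin; lra.
Qed.

Lemma half_turn_continuity X : in_D X -> continuity (half_turn X).
Proof.
  intros HX t; apply continuity_pt_filterlim.
  apply (ex_derive_continuous (V := R_NormedModule)).
  assert (Hmink := mink_on_S1_pos X (circ t) HX (circ_on_S1 t)).
  unfold half_turn, wedge, mink, circ in *; simpl in *; auto_derive; lra.
Qed.

Lemma half_turn_is_lift X : in_D X -> half_turn_lift (half_turn X).
Proof.
  intro HX; split.
  - now apply half_turn_continuity.
  - now intros x y; apply half_turn_increasing.
  - now intro t; apply half_turn_square.
Qed.

(** * Ideal triangles through three points *)

(* The chords from [circ t] through [P], onwards through [Q], and onwards through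
   [Rv] form a closed ideal triangle; the two cases are its orientations. *)
Definition has_ideal_circumtriangle (P Q Rv : pt) : Prop :=
  exists t, half_turn Rv (half_turn Q (half_turn P t)) = t + 1 \/
            half_turn Rv (half_turn Q (half_turn P t)) = t + 2.

Lemma quadratic_form_isotropic a b c :
  (exists s t, (s, t) <> (0, 0) /\ a * s ^ 2 + b * s * t + c * t ^ 2 = 0) <->
  4 * (a * c) <= b ^ 2.
Proof.
  split.
  - intros (s & t & Hst & E).
    assert (Es : (b ^ 2 - 4 * (a * c)) * s ^ 2 = (2 * c * t + b * s) ^ 2
                - 4 * c * (a * s ^ 2 + b * s * t + c * t ^ 2)) by ring.
    assert (Et : (b ^ 2 - 4 * (a * c)) * t ^ 2 = (2 * a * s + b * t) ^ 2
                - 4 * a * (a * s ^ 2 + b * s * t + c * t ^ 2)) by ring.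
    rewrite E in Es, Et.
    generalize (pow2_ge_0 (2 * c * t + b * s)) (pow2_ge_0 (2 * a * s + b * t)).
    destruct (Req_dec s 0) as [-> | Hs].
    + assert (Ht : t <> 0) by (intros ->; now apply Hst).
      apply pow2_gt_0 in Ht; nra.
    + apply pow2_gt_0 in Hs; nra.
  - intro H; destruct (Req_dec a 0) as [-> | Ha].
    + exists 1, 0; split; [intro E; injection E; lra | ring].
    + set (d := sqrt (b ^ 2 - 4 * (a * c))).
      assert (Hd : d ^ 2 = b ^ 2 - 4 * (a * c)) by (apply pow2_sqrt; lra).
      exists ((- b + d) / (2 * a)), 1; split; [intro E; injection E; lra|].
      transitivity ((d ^ 2 - (b ^ 2 - 4 * (a * c))) / (4 * a)); [now field|].
      rewrite Hd; now field.
Qed.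

(* The isotropic vectors of this quadratic form are the real eigenvectors of the
   product of the three matrices, which has trace [2 * cross P Q Rv] up to sign
   and determinant the product on the right. *)
Lemma act_eigenvector_iff P Q Rv :
  (exists a, a <> (0, 0) /\ wedge a (act Rv (act Q (act P a))) = 0) <->
  mink P P * mink Q Q * mink Rv Rv <= cross P Q Rv ^ 2.
Proof.
  set (form := fun a => wedge a (act Rv (act Q (act P a)))).
  set (a := form (1, 0)); set (c := form (0, 1)); set (b := form (1, 1) - a - c).
  assert (Eform : forall s t, form (s, t) = a * s ^ 2 + b * s * t + c * t ^ 2)
    by (intros; unfold b, a, c, form, wedge, act; simpl; ring).
  assert (Hdisc : b ^ 2 - 4 * (a * c)
                  = 4 * (cross P Q Rv ^ 2 - mink P P * mink Q Q * mink Rv Rv))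
    by (unfold b, a, c, form, wedge, act, cross, mink; simpl; ring).
  transitivity (exists s t, (s, t) <> (0, 0) /\
                            a * s ^ 2 + b * s * t + c * t ^ 2 = 0).
  - split.
    + intros [[s t] [Hst E]]; exists s, t; now rewrite <- Eform.
    + intros (s & t & Hst & E); exists (s, t); rewrite <- Eform in E; now split.
  - rewrite quadratic_form_isotropic; lra.
Qed.

Lemma wedge_ray_act3 P Q Rv t : in_D P -> in_D Q -> in_D Rv ->
  exists k, k <> 0 /\ wedge (ray t) (act Rv (act Q (act P (ray t))))
    = k * sin (PI * (half_turn Rv (half_turn Q (half_turn P t)) - t)).
Proof.
  intros HP HQ HR; destruct (act_ray P t HP) as (k & Hk & Ek).
  destruct (act_ray Q (half_turn P t) HQ) as (l & Hl & El).
  destruct (act_ray Rv (half_turn Q (half_turn P t)) HR) as (m & Hm & Em).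
  exists (- k * - l * - m); split.
  - repeat apply Rmult_integral_contrapositive_currified; lra.
  - now rewrite Ek, act_scale, El, !act_scale, Em, !scale_scale, wedge_scale_r,
      wedge_ray.
Qed.

Lemma has_ideal_circumtriangle_iff P Q Rv : in_D P -> in_D Q -> in_D Rv ->
  has_ideal_circumtriangle P Q Rv <->
  mink P P * mink Q Q * mink Rv Rv <= cross P Q Rv ^ 2.
Proof.
  intros HP HQ HR; rewrite <- act_eigenvector_iff; split.
  - intros [t Ht]; exists (ray t); split; [apply ray_neq0|].
    destruct (wedge_ray_act3 P Q Rv t HP HQ HR) as (k & _ & ->).
    assert (exists n, half_turn Rv (half_turn Q (half_turn P t)) - t = IZR n)
      as [n ->] by (destruct Ht; [exists 1%Z | exists 2%Z]; lra).
    rewrite sin_PI_mul_IZR; ring.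
  - intros (a & Ha & E); destruct (ray_exists a Ha) as (k & t & Hk & ->).
    destruct (wedge_ray_act3 P Q Rv t HP HQ HR) as (l & Hl & El).
    rewrite !act_scale, wedge_scale_r, wedge_scale_l, El in E.
    destruct (sin_PI_mul_eq0 (half_turn Rv (half_turn Q (half_turn P t)) - t))
      as [n Hn].
    { apply Rmult_integral in E as [E | E]; [easy|].
      apply Rmult_integral in E as [E | E]; [easy|].
      now apply Rmult_integral in E as [E | E]. }
    generalize (half_turn_bounds P t) (half_turn_bounds Q (half_turn P t))
      (half_turn_bounds Rv (half_turn Q (half_turn P t))); intros.
    assert (0 < n < 3)%Z by (split; apply lt_IZR; lra).
    exists t; assert (n = 1 \/ n = 2)%Z as [-> | ->] by lia; [left | right]; lra.
Qed.

Lemma has_ideal_circumtriangle_permute P Q Rv X Y Z : in_D P -> in_D Q -> in_D Rv ->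
  among3 P Q Rv X -> among3 P Q Rv Y -> among3 P Q Rv Z ->
  X <> Y -> Y <> Z -> Z <> X ->
  has_ideal_circumtriangle X Y Z -> has_ideal_circumtriangle P Q Rv.
Proof.
  intros HP HQ HR HX HY HZ HXY HYZ HZX.
  assert (Hin := among3_forall in_D P Q Rv HP HQ HR).
  rewrite !has_ideal_circumtriangle_iff by auto.
  destruct HX as [-> | [-> | ->]], HY as [-> | [-> | ->]], HZ as [-> | [-> | ->]];
    try easy; unfold cross; lra.
Qed.

(** * Lines and chords *)

Definition line_pt (a b : pt) (s : R) : pt :=
  (fst a + s * (fst b - fst a), snd a + s * (snd b - snd a)).

Lemma sqr_dist_pos (a b : pt) :
  a <> b -> 0 < (fst a - fst b) ^ 2 + (snd a - snd b) ^ 2.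
Proof.
  destruct a as [x y], b as [z w]; simpl fst; simpl snd; intro Hne.
  generalize (pow2_ge_0 (x - z)) (pow2_ge_0 (y - w)).
  destruct (Req_dec x z) as [<- | Hxz].
  - assert (Hyw : y - w <> 0) by (intro; apply Hne; f_equal; lra).
    apply pow2_gt_0 in Hyw; lra.
  - assert (Hdiff : x - z <> 0) by lra; apply pow2_gt_0 in Hdiff; lra.
Qed.

Lemma on_line_iff a b X : a <> b -> on_line a b X <-> exists s, X = line_pt a b s.
Proof.
  intro Hne; assert (Hpos := sqr_dist_pos b a (not_eq_sym Hne)); split.
  - destruct a as [a1 a2], b as [b1 b2], X as [x y].
    unfold on_line, cross, line_pt; simpl fst in *; simpl snd in *; intro E.
    set (c := (b1 - a1) * (y - a2) - (b2 - a2) * (x - a1)) in E.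
    set (L := (b1 - a1) ^ 2 + (b2 - a2) ^ 2) in Hpos.
    set (s := ((x - a1) * (b1 - a1) + (y - a2) * (b2 - a2)) / L).
    exists s; f_equal.
    + transitivity (a1 + s * (b1 - a1) - (b2 - a2) * c / L);
        [unfold s, c, L in *; field; lra | rewrite E; field; lra].
    + transitivity (a2 + s * (b2 - a2) + (b1 - a1) * c / L);
        [unfold s, c, L in *; field; lra | rewrite E; field; lra].
  - intros [s ->]; unfold on_line, cross, line_pt; simpl; ring.
Qed.

Lemma on_line_common_line a b P Q X : a <> b ->
  on_line a b P -> on_line a b Q -> on_line a b X -> on_line P Q X.
Proof.
  intros Hne HP HQ HX.
  apply on_line_iff in HP as [p ->], HQ as [q ->], HX as [x ->]; trivial.
  unfold on_line, cross, line_pt; simpl; ring.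
Qed.

Lemma cross_line_pt a b s t X :
  cross (line_pt a b s) (line_pt a b t) X = (t - s) * cross a b X.
Proof. unfold cross, line_pt; simpl; ring. Qed.

Lemma cross_circ X t u : cross (circ t) (circ u) X =
  2 * wedge (ray t) (ray u) * wedge (act X (ray t)) (ray u).
Proof.
  rewrite !circ_ray; unfold cross, wedge, act, ray; simpl.
  assert (Et := sin2_cos2 (PI * t)); assert (Eu := sin2_cos2 (PI * u)).
  unfold Rsqr in Et, Eu; nsatz.
Qed.

Lemma cross_circ_half_turn X t : in_D X ->
  exists k, 0 < k /\ forall u, cross (circ t) (circ u) X =
    k * sin (PI * (u - t)) * sin (PI * (half_turn X t - u)).
Proof.
  intro HX; destruct (act_ray X t HX) as (k & Hk & E).
  exists (2 * k); split; [lra|]; intro u.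
  rewrite cross_circ, E, wedge_scale_l, !wedge_ray.
  rewrite <- (Ropp_minus_distr u (half_turn X t)), <- Ropp_mult_distr_r, sin_neg.
  ring.
Qed.

Lemma cross_circ_pos X t u :
  in_D X -> t < u < half_turn X t -> 0 < cross (circ t) (circ u) X.
Proof.
  intros HX Hu; destruct (cross_circ_half_turn X t HX) as (k & Hk & ->).
  generalize (half_turn_bounds X t); intro.
  repeat apply Rmult_lt_0_compat; trivial; apply sin_PI_mul_pos; lra.
Qed.

Lemma on_line_circ_half_turn X t :
  in_D X -> on_line (circ t) (circ (half_turn X t)) X.
Proof.
  intro HX; unfold on_line; destruct (cross_circ_half_turn X t HX) as (k & _ & ->).
  rewrite Rminus_diag, Rmult_0_r, sin_0; ring.
Qed.

Lemma circ_shift_IZR t k : circ (t + IZR k) = circ t.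
Proof.
  unfold circ.
  replace (2 * PI * (t + IZR k)) with (2 * PI * t + 2 * (PI * IZR k)) by ring.
  rewrite cos_plus, sin_plus, cos_2a_sin, sin_2a, sin_PI_mul_IZR; f_equal; ring.
Qed.

Lemma circ_neq t u : t < u < t + 1 -> circ t <> circ u.
Proof.
  intros Hu E.
  assert (Hsin := sin_PI_mul_pos (u - t) ltac:(lra)).
  assert (Hcos : cos (2 * (PI * (u - t))) = 1).
  { replace (2 * (PI * (u - t))) with (2 * PI * u - 2 * PI * t) by ring.
    injection E as Ecos Esin; rewrite cos_minus, <- Ecos, <- Esin.
    rewrite Rplus_comm; apply sin2_cos2. }
  rewrite cos_2a_sin in Hcos; nra.
Qed.

Lemma half_turns_noncoincident P Q Rv t : in_D P -> in_D Q -> in_D Rv ->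
  nondegenerate P Q Rv ->
  ~ (half_turn P t = half_turn Q t /\ half_turn Q t = half_turn Rv t).
Proof.
  intros HP HQ HR Hnd [EPQ EQR]; apply Hnd.
  apply (on_line_common_line (circ t) (circ (half_turn P t))).
  - apply circ_neq, half_turn_bounds.
  - now apply on_line_circ_half_turn.
  - rewrite EPQ; now apply on_line_circ_half_turn.
  - rewrite EPQ, EQR; now apply on_line_circ_half_turn.
Qed.

(** * The support map and its lift *)

Lemma epsilon_unique {A : Type} (i : inhabited A) (pred : A -> Prop) (x : A) :
  pred x -> (forall y, pred y -> y = x) -> epsilon i pred = x.
Proof. intros Hx Huniq; apply Huniq, epsilon_spec; now exists x. Qed.

Lemma piS1_bounds x : 0 <= piS1 x < 1.
Proof. destruct (base_fp x); unfold frac_part in *; unfold piS1; lra. Qed.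

Lemma piS1_decomp x : exists k, x = piS1 x + IZR k.
Proof. exists (Int_part x); unfold piS1; ring. Qed.

Lemma piS1_unique x y k : 0 <= y < 1 -> x = y + IZR k -> piS1 x = y.
Proof.
  intros Hy E; symmetry; rewrite Rplus_comm in E.
  exact (proj2 (Int_part_frac_part_spec x k y Hy E)).
Qed.

Lemma piS1_eq_iff x y : piS1 x = piS1 y <-> exists k, x = y + IZR k.
Proof.
  destruct (piS1_decomp y) as [l Hl]; split.
  - intro E; destruct (piS1_decomp x) as [k Hk].
    exists (k - l)%Z; rewrite minus_IZR; lra.
  - intros [k Hk]; apply (piS1_unique x _ (l + k)); [apply piS1_bounds|].
    rewrite plus_IZR; lra.
Qed.

Lemma circ_piS1 t : circ (piS1 t) = circ t.
Proof.
  destruct (piS1_decomp t) as [k Hk]; rewrite Hk at 2; symmetry.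
  apply circ_shift_IZR.
Qed.

Lemma continuity_integer_valued_constant h :
  continuity h -> (forall x, exists k : Z, h x = IZR k) -> forall x y, h x = h y.
Proof.
  intros Hcont Hint.
  assert (Hnlt : forall x y, ~ h x < h y).
  { intros x y Hlt; destruct (Hint x) as [k Hk], (Hint y) as [l Hl].
    rewrite Hk, Hl in Hlt; apply lt_IZR in Hlt.
    assert (Hstep : IZR (k + 1) <= IZR l) by (apply IZR_le; lia).
    rewrite plus_IZR in Hstep.
    destruct (continuity_zero_between (fun z => h z - (IZR k + 1 / 2)) x y)
      as [z Hz]; [| lra |].
    - apply continuity_minus; [exact Hcont|].
      apply continuity_const; now intros ? ?.
    - destruct (Hint z) as [m Hm].
      assert (k < m < k + 1)%Z by (split; apply lt_IZR; rewrite ?plus_IZR; lra).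
      lia. }
  intros x y; generalize (Hnlt x y) (Hnlt y x); lra.
Qed.

Lemma circle_lift_unique (F G : R -> R) : continuity F -> continuity G ->
  (forall x, piS1 (F x) = piS1 (G x)) -> 0 < F 0 < 1 -> 0 < G 0 < 1 -> F = G.
Proof.
  intros HF HG Hpi HF0 HG0; apply functional_extensionality; intro x.
  assert (Hint : forall y, exists k : Z, F y - G y = IZR k).
  { intro y; destruct (proj1 (piS1_eq_iff _ _) (Hpi y)) as [k Hk].
    exists k; lra. }
  assert (Econst : F x - G x = F 0 - G 0)
    by exact (continuity_integer_valued_constant _ (continuity_minus F G HF HG)
                Hint x 0).
  destruct (Hint 0) as [k Hk].
  assert (-1 < k < 1)%Z by (split; apply lt_IZR; lra).
  replace k with 0%Z in Hk by lia; lra.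
Qed.

Lemma in_triangle_vertices P Q Rv :
  in_triangle P Q Rv P /\ in_triangle P Q Rv Q /\ in_triangle P Q Rv Rv.
Proof.
  split; [| split]; [exists 1, 0, 0 | exists 0, 1, 0 | exists 0, 0, 1];
    repeat split; lra.
Qed.

Lemma cross_convex_combination P Q Rv X a b u v w : u + v + w = 1 ->
  fst X = u * fst P + v * fst Q + w * fst Rv ->
  snd X = u * snd P + v * snd Q + w * snd Rv ->
  cross a b X = u * cross a b P + v * cross a b Q + w * cross a b Rv.
Proof.
  intros E Ex Ey; unfold cross; rewrite Ex, Ey.
  replace w with (1 - u - v) by lra; ring.
Qed.

Lemma in_triangle_cross_min P Q Rv X a b : in_triangle P Q Rv X ->
  exists V, among3 P Q Rv V /\ cross a b V <= cross a b X.
Proof.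
  intros (u & v & w & Hu & Hv & Hw & E & Ex & Ey); unfold among3.
  assert (EX := cross_convex_combination P Q Rv X a b u v w E Ex Ey).
  destruct (Rle_lt_dec (cross a b P) (cross a b X)) as [| LP]; [eauto|].
  destruct (Rle_lt_dec (cross a b Q) (cross a b X)) as [| LQ]; [eauto|].
  destruct (Rle_lt_dec (cross a b Rv) (cross a b X)) as [| LR]; [eauto|].
  exfalso.
  assert (0 <= u * (cross a b P - cross a b X)) by (apply Rmult_le_pos; lra).
  assert (0 <= v * (cross a b Q - cross a b X)) by (apply Rmult_le_pos; lra).
  assert (0 <= w * (cross a b Rv - cross a b X)) by (apply Rmult_le_pos; lra).
  assert (Esum : u * (cross a b P - cross a b X) + v * (cross a b Q - cross a b X)
                 + w * (cross a b Rv - cross a b X) = 0)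
    by (rewrite EX; replace w with (1 - u - v) by lra; ring).
  assert (u = 0) by nra; assert (v = 0) by nra; assert (w = 0) by nra; lra.
Qed.

Section SupportMap.

Variables P Q Rv : pt.
Hypothesis HP : in_D P.
Hypothesis HQ : in_D Q.
Hypothesis HR : in_D Rv.

Let F := min3 (half_turn P) (half_turn Q) (half_turn Rv).

Lemma min3_half_turn_attained t :
  exists X, among3 P Q Rv X /\ in_D X /\ F t = half_turn X t.
Proof.
  destruct (min3_pointwise_min (half_turn P) (half_turn Q) (half_turn Rv) t)
    as [_ (f & Hf & E)].
  apply among3_map in Hf as (X & HX & ->); exists X.
  now split; [| split; [apply (among3_forall in_D P Q Rv)|]].
Qed.

Lemma min3_half_turn_le X t : among3 P Q Rv X -> F t <= half_turn X t.
Proof.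
  intro HX; apply (min3_pointwise_min (half_turn P) (half_turn Q) (half_turn Rv) t).
  apply among3_map; eauto.
Qed.

Lemma min3_half_turn_bounds t : t < F t < t + 1.
Proof.
  destruct (min3_half_turn_attained t) as (X & _ & _ & ->); apply half_turn_bounds.
Qed.

Lemma supports_ge_min3 t u : t < u < t + 1 ->
  supports P Q Rv (circ t) (circ u) -> F t <= u.
Proof.
  intros Hu (_ & (X & HX & E) & _); apply Rnot_lt_le; intro Hlt.
  destruct (in_triangle_cross_min P Q Rv X (circ t) (circ u) HX) as (V & HV & HVX).
  enough (0 < cross (circ t) (circ u) V) by lra.
  apply cross_circ_pos; [now apply (among3_forall in_D P Q Rv)|].
  generalize (min3_half_turn_le V t HV); lra.
Qed.

Lemma supports_min3 t : supports P Q Rv (circ t) (circ (F t)).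
Proof.
  split; [apply circ_neq, min3_half_turn_bounds | split].
  - destruct (in_triangle_vertices P Q Rv) as (VP & VQ & VR).
    destruct (min3_half_turn_attained t) as (X & HX & DX & ->); exists X.
    split; [| now apply on_line_circ_half_turn].
    now apply (among3_forall (in_triangle P Q Rv) P Q Rv).
  - left; intros X HX.
    destruct (in_triangle_cross_min P Q Rv X (circ t) (circ (F t)) HX)
      as (V & HV & HVX).
    apply Rle_trans with (2 := HVX).
    assert (DV : in_D V) by now apply (among3_forall in_D P Q Rv).
    destruct (min3_half_turn_le V t HV) as [Hlt | ->].
    + left; apply cross_circ_pos; [exact DV|].
      generalize (min3_half_turn_bounds t); lra.
    + right; symmetry; now apply on_line_circ_half_turn.
Qed.

Lemma piS1_min3_offset t : piS1 (piS1 (F t) - t) = F t - t.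
Proof.
  destruct (piS1_decomp (F t)) as [k Hk].
  apply (piS1_unique _ _ (- k)); [| rewrite opp_IZR; lra].
  generalize (min3_half_turn_bounds t); lra.
Qed.

Lemma is_psi_min3 t : is_psi P Q Rv t (piS1 (F t)).
Proof.
  assert (Hb := min3_half_turn_bounds t).
  split; [apply piS1_bounds|]; rewrite piS1_min3_offset, circ_piS1.
  split; [lra | split; [apply supports_min3|]].
  intros u Hu Hoffset Hsup; destruct (piS1_bounds (u - t)).
  destruct (piS1_decomp (u - t)) as [k Hk].
  rewrite <- (circ_shift_IZR u (- k)) in Hsup.
  apply supports_ge_min3 in Hsup; rewrite opp_IZR in *; lra.
Qed.

Lemma is_psi_unique t u v : is_psi P Q Rv t u -> is_psi P Q Rv t v -> u = v.
Proof.
  intros (Hu & Hu0 & Su & Lu) (Hv & Hv0 & Sv & Lv).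
  assert (E : piS1 (u - t) = piS1 (v - t)) by (apply Rle_antisym; auto).
  apply piS1_eq_iff in E as [k Hk].
  rewrite <- (piS1_unique u u 0), <- (piS1_unique v v 0) by lra.
  apply piS1_eq_iff; exists k; lra.
Qed.

Lemma psi_min3 t : psi P Q Rv t = piS1 (F t).
Proof.
  apply epsilon_unique; [apply is_psi_min3|].
  intros u Hu; exact (is_psi_unique t _ _ Hu (is_psi_min3 t)).
Qed.

Lemma is_lift_min3 : is_lift P Q Rv F.
Proof.
  assert (HF : degree_one F)
    by (apply min3_degree_one; now apply half_turn_is_lift).
  split; [apply min3_continuity; now apply half_turn_is_lift | split].
  - intro x; rewrite psi_min3; apply piS1_eq_iff.
    destruct (piS1_decomp x) as [k Hk]; exists k.
    rewrite <- (degree_one_IZR F _ _ HF); now f_equal.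
  - generalize (min3_half_turn_bounds 0); lra.
Qed.

Lemma psibar_min3 : psibar P Q Rv = F.
Proof.
  destruct is_lift_min3 as (Fcont & Fpi & F0).
  apply epsilon_unique; [exact is_lift_min3|].
  intros G (Gcont & Gpi & G0); apply circle_lift_unique; trivial.
  intro x; now rewrite Gpi, Fpi.
Qed.

Lemma rho_is_translation_number : translation_number F (rho P Q Rv).
Proof.
  unfold rho; rewrite psibar_min3; apply (epsilon_spec (inhabits 0)).
  apply translation_number_exists, min3_degree_one; now apply half_turn_is_lift.
Qed.

Lemma min3_iter3_eq_succ_iff : nondegenerate P Q Rv ->
  (exists x, F (F (F x)) = x + 1) <-> has_ideal_circumtriangle P Q Rv.
Proof.
  intro Hnd.
  assert (LP := half_turn_is_lift P HP); assert (LQ := half_turn_is_lift Q HQ).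
  assert (LR := half_turn_is_lift Rv HR); split.
  - intros [x Hx].
    assert (Hbelow := min3_lt_some _ _ _
                        (fun y => half_turns_noncoincident P Q Rv y HP HQ HR Hnd)).
    destruct (pointwise_min_iter3_distinct _ F (among3_forall _ _ _ _ LP LQ LR)
                (min3_pointwise_min _ _ _) x Hbelow Hx)
      as (f & g & h & Hf & Hg & Hh & Hfg & Hgh & Hhf & E).
    apply among3_map in Hf as (X & HX & ->), Hg as (Y & HY & ->),
      Hh as (Z & HZ & ->).
    apply (has_ideal_circumtriangle_permute P Q Rv X Y Z); trivial; try congruence.
    exists x; auto.
  - intros [x [E | E]]; exists x.
    + now apply min3_iter3_of_cycle.
    + apply half_turn_lift_cycle_reverse in E; trivial.
      unfold F; rewrite !(min3_reverse (half_turn P)).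
      now apply min3_iter3_of_cycle.
Qed.

Lemma rho_eq_third : nondegenerate P Q Rv ->
  has_ideal_circumtriangle P Q Rv -> rho P Q Rv = 1 / 3.
Proof.
  intros Hnd H; apply min3_iter3_eq_succ_iff in H; trivial.
  apply (translation_number_min3_eq_third
           (half_turn P) (half_turn Q) (half_turn Rv));
    auto using half_turn_is_lift, rho_is_translation_number.
Qed.

Lemma rho_between : nondegenerate P Q Rv ->
  ~ has_ideal_circumtriangle P Q Rv -> 1 / 3 < rho P Q Rv < 1 / 2.
Proof.
  intros Hnd H; rewrite <- min3_iter3_eq_succ_iff in H by trivial.
  apply (translation_number_min3_between
           (half_turn P) (half_turn Q) (half_turn Rv));
    auto using half_turn_is_lift, rho_is_translation_number.
  - intro x; now apply half_turns_noncoincident.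
  - intros x Hx; apply H; now exists x.
Qed.

End SupportMap.

(** * Hyperbolic distances in the Klein model *)

Local Notation dist := Defs.dist.

Lemma sinh_le_iff x y : sinh x <= sinh y <-> x <= y.
Proof.
  split; intro H.
  - apply Rnot_lt_le; intro Hlt; apply sinh_lt in Hlt; lra.
  - destruct H as [H | ->]; [left; now apply sinh_lt | apply Rle_refl].
Qed.

Lemma sinh_nonneg x : 0 <= x -> 0 <= sinh x.
Proof. intro H; apply sinh_le_iff in H; now rewrite sinh_0 in H. Qed.

Lemma sinh_half_abs_ln_sqr r : 0 < r ->
  sinh (/ 2 * Rabs (ln r)) ^ 2 = (r - 1) ^ 2 / (4 * r).
Proof.
  intro Hr; set (y := / 2 * ln r).
  assert (Habs : sinh (/ 2 * Rabs (ln r)) ^ 2 = sinh y ^ 2).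
  { unfold y, Rabs; destruct (Rcase_abs (ln r)); [| reflexivity].
    unfold sinh; rewrite <- Ropp_mult_distr_r, Ropp_involutive; field. }
  assert (Hexp : exp y ^ 2 = r).
  { rewrite <- (exp_ln r Hr) at 1; simpl; rewrite Rmult_1_r, <- exp_plus.
    f_equal; unfold y; field. }
  rewrite Habs; unfold sinh; rewrite exp_Ropp.
  assert (Hpos := exp_pos y).
  rewrite <- Hexp; field; lra.
Qed.

Lemma sinh_mul_sinh_ln_coth_half d : 0 < d ->
  sinh (ln ((exp d + 1) / (exp d - 1))) * sinh d = 1.
Proof.
  intro Hd; assert (He : 1 < exp d) by (rewrite <- exp_0; now apply exp_increasing).
  assert (Hpos : 0 < (exp d + 1) / (exp d - 1)) by (apply Rdiv_lt_0_compat; lra).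
  unfold sinh; rewrite !exp_Ropp, exp_ln by exact Hpos.
  field; nra.
Qed.

Lemma line_pt_0 a b : line_pt a b 0 = a.
Proof. destruct a; unfold line_pt; simpl; f_equal; ring. Qed.

Lemma line_pt_1 a b : line_pt a b 1 = b.
Proof. destruct b; unfold line_pt; simpl; f_equal; ring. Qed.

Lemma dist_line_pt a b s t :
  dist (line_pt a b s) (line_pt a b t) = Rabs (s - t) * dist a b.
Proof.
  unfold dist; rewrite <- sqrt_Rsqr_abs, <- sqrt_mult_alt by apply Rle_0_sqr.
  f_equal; unfold line_pt, Rsqr; simpl; ring.
Qed.

Lemma mink_line_pt_r X a b s :
  mink X (line_pt a b s) = (1 - s) * mink X a + s * mink X b.
Proof. unfold mink, line_pt; simpl; ring. Qed.

Lemma mink_gram_line_pt a b s t :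
  mink (line_pt a b s) (line_pt a b t) ^ 2
    - mink (line_pt a b s) (line_pt a b s) * mink (line_pt a b t) (line_pt a b t)
  = (t - s) ^ 2 * (mink a b ^ 2 - mink a a * mink b b).
Proof. unfold mink, line_pt; simpl; ring. Qed.

(* The Gram determinant of the homogeneous vectors of three points is the square
   of their determinant. *)
Lemma cross_sqr_gram a b c : cross a b c ^ 2 =
  mink a a * (mink b b * mink c c - mink b c ^ 2)
  - mink a b * (mink a b * mink c c - mink b c * mink a c)
  + mink a c * (mink a b * mink b c - mink b b * mink a c).
Proof. unfold cross, mink; simpl; ring. Qed.

Section Chord.

Variables v1 v2 : pt.
Hypothesis v1_ideal : on_S1 v1.
Hypothesis v2_ideal : on_S1 v2.
Hypothesis v12_neq : v1 <> v2.

Lemma mink_ideal_pos : 0 < mink v1 v2.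
Proof.
  generalize (sqr_dist_pos v1 v2 v12_neq); unfold on_S1, mink in *; lra.
Qed.

Lemma mink_chord_pt s : mink (line_pt v1 v2 s) (line_pt v1 v2 s)
  = 2 * (s * (1 - s)) * mink v1 v2.
Proof.
  rewrite mink_line_pt_r, !(mink_sym (line_pt v1 v2 s)), !mink_line_pt_r.
  rewrite (mink_sym v2 v1), !mink_on_S1 by assumption; ring.
Qed.

Lemma chord_pt_in_D_iff s : in_D (line_pt v1 v2 s) <-> 0 < s < 1.
Proof.
  rewrite mink_diag_pos, mink_chord_pt; assert (Hm := mink_ideal_pos).
  split; intro H; [| repeat apply Rmult_lt_0_compat; lra].
  assert (Hs : 0 < s * (1 - s)) by nra; nra.
Qed.

Lemma in_D_on_chord X : in_D X -> on_line v1 v2 X ->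
  exists s, 0 < s < 1 /\ X = line_pt v1 v2 s.
Proof.
  intros HX HL; apply on_line_iff in HL as [s ->]; [| exact v12_neq].
  exists s; now rewrite <- chord_pt_in_D_iff.
Qed.

Lemma chord_cross_ratio p q : 0 < p < 1 -> 0 < q < 1 ->
  dist v1 (line_pt v1 v2 q) * dist v2 (line_pt v1 v2 p)
    / (dist v1 (line_pt v1 v2 p) * dist v2 (line_pt v1 v2 q))
  = q * (1 - p) / (p * (1 - q)).
Proof.
  intros Hp Hq.
  assert (Hd : 0 < dist v1 v2) by (apply sqrt_lt_R0; now apply sqr_dist_pos).
  assert (D1 : forall s, 0 < s < 1 -> dist v1 (line_pt v1 v2 s) = s * dist v1 v2).
  { intros s Hs; rewrite <- (line_pt_0 v1 v2) at 1; rewrite dist_line_pt.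
    rewrite Rabs_left by lra; ring. }
  assert (D2 : forall s, 0 < s < 1 ->
                 dist v2 (line_pt v1 v2 s) = (1 - s) * dist v1 v2).
  { intros s Hs; rewrite <- (line_pt_1 v1 v2) at 1; rewrite dist_line_pt.
    rewrite Rabs_pos_eq by lra; ring. }
  rewrite !D1, !D2 by assumption; field; lra.
Qed.

End Chord.

Lemma chord_through_exists P Q :
  in_D P -> in_D Q -> exists v1 v2, chord_through P Q v1 v2.
Proof.
  intros HP HQ.
  destruct (half_turn_lifts_meet (half_turn_is_lift P HP) (half_turn_is_lift Q HQ))
    as [t E].
  exists (circ t), (circ (half_turn P t)).
  split; [| split; [| split; [| split]]]; try apply circ_on_S1.
  - apply circ_neq, half_turn_bounds.
  - now apply on_line_circ_half_turn.
  - rewrite E; now apply on_line_circ_half_turn.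
Qed.

Lemma dprime_chord_pts P Q : in_D P -> in_D Q ->
  exists v1 v2 p q, on_S1 v1 /\ on_S1 v2 /\ v1 <> v2 /\
    0 < p < 1 /\ 0 < q < 1 /\ P = line_pt v1 v2 p /\ Q = line_pt v1 v2 q /\
    dprime P Q = / 2 * Rabs (ln (q * (1 - p) / (p * (1 - q)))).
Proof.
  intros HP HQ.
  assert (Hex : exists d v1 v2, chord_through P Q v1 v2 /\
    d = / 2 * Rabs (ln ((dist v1 Q * dist v2 P) / (dist v1 P * dist v2 Q))))
    by (destruct (chord_through_exists P Q HP HQ) as (v1 & v2 & H); eauto).
  destruct (epsilon_spec (inhabits 0) _ Hex)
    as (v1 & v2 & (S1 & S2 & Hne & LP & LQ) & Ed).
  fold (dprime P Q) in Ed.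
  destruct (in_D_on_chord v1 v2 S1 S2 Hne P HP LP) as (p & Hp & EP).
  destruct (in_D_on_chord v1 v2 S1 S2 Hne Q HQ LQ) as (q & Hq & EQ).
  exists v1, v2, p, q; repeat split; try assumption; try lra.
  rewrite Ed, EP, EQ, chord_cross_ratio by assumption; reflexivity.
Qed.

Lemma dprime_nonneg P Q : in_D P -> in_D Q -> 0 <= dprime P Q.
Proof.
  intros HP HQ.
  destruct (dprime_chord_pts P Q HP HQ)
    as (v1 & v2 & p & q & _ & _ & _ & _ & _ & _ & _ & ->).
  apply Rmult_le_pos; [lra | apply Rabs_pos].
Qed.

Lemma sinh_dprime_sqr P Q : in_D P -> in_D Q ->
  mink P P * mink Q Q * sinh (dprime P Q) ^ 2 = mink P Q ^ 2 - mink P P * mink Q Q.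
Proof.
  intros HP HQ.
  destruct (dprime_chord_pts P Q HP HQ)
    as (v1 & v2 & p & q & S1 & S2 & Hne & Hp & Hq & -> & -> & ->).
  rewrite sinh_half_abs_ln_sqr by (apply Rdiv_lt_0_compat; nra).
  rewrite mink_gram_line_pt, !mink_chord_pt, !(mink_on_S1 v1) by assumption.
  field; lra.
Qed.

Lemma dprime_pos P Q : in_D P -> in_D Q -> P <> Q -> 0 < dprime P Q.
Proof.
  intros HP HQ Hne; destruct (dprime_nonneg P Q HP HQ) as [H | H]; [exact H|].
  assert (E := sinh_dprime_sqr P Q HP HQ); rewrite <- H, sinh_0 in E.
  assert (Egram : mink P Q ^ 2 - mink P P * mink Q Q
    = (fst P * (fst P - fst Q) + snd P * (snd P - snd Q)) ^ 2
      + ((fst P - fst Q) ^ 2 + (snd P - snd Q) ^ 2) * mink P P)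
    by (unfold mink; ring).
  apply mink_diag_pos in HP; apply sqr_dist_pos in Hne.
  generalize (pow2_ge_0 (fst P * (fst P - fst Q) + snd P * (snd P - snd Q))); nra.
Qed.

Section DistanceToChord.

Variables v1 v2 Rv : pt.
Hypothesis v1_ideal : on_S1 v1.
Hypothesis v2_ideal : on_S1 v2.
Hypothesis v12_neq : v1 <> v2.
Hypothesis HR : in_D Rv.

Lemma cross_sqr_ideal : cross v1 v2 Rv ^ 2
  = mink v1 v2 * (2 * mink Rv v1 * mink Rv v2 - mink v1 v2 * mink Rv Rv).
Proof.
  rewrite cross_sqr_gram, !(mink_on_S1 v1), !(mink_on_S1 v2) by assumption.
  rewrite (mink_sym v1 Rv), (mink_sym v2 Rv); ring.
Qed.

(* The right-hand side is the defect in the AM-GM inequality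
   [4 (1 - s) A * s B <= ((1 - s) A + s B) ^ 2] for [A = mink Rv v1] and
   [B = mink Rv v2]; it vanishes at the foot of the perpendicular from [Rv]. *)
Lemma sinh_dprime_chord_pt s : 0 < s < 1 ->
  2 * (s * (1 - s)) * (mink v1 v2 ^ 2 * mink Rv Rv
                         * sinh (dprime Rv (line_pt v1 v2 s)) ^ 2
                       - cross v1 v2 Rv ^ 2)
  = mink v1 v2 * ((1 - s) * mink Rv v1 - s * mink Rv v2) ^ 2.
Proof.
  intro Hs; rewrite <- (chord_pt_in_D_iff v1 v2) in Hs by assumption.
  assert (E := sinh_dprime_sqr Rv _ HR Hs).
  rewrite mink_chord_pt, mink_line_pt_r in E by assumption.
  rewrite cross_sqr_ideal; set (h := sinh _) in *.
  transitivity (mink v1 v2 * (mink Rv Rv * (2 * (s * (1 - s)) * mink v1 v2) * h ^ 2)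
    - 2 * (s * (1 - s)) * (mink v1 v2
        * (2 * mink Rv v1 * mink Rv v2 - mink v1 v2 * mink Rv Rv))); [ring|].
  rewrite E; ring.
Qed.

Lemma sinh_dprime_chord_ge X : in_D X -> on_line v1 v2 X ->
  cross v1 v2 Rv ^ 2 <= mink v1 v2 ^ 2 * mink Rv Rv * sinh (dprime Rv X) ^ 2.
Proof.
  intros HX HL.
  destruct (in_D_on_chord v1 v2 v1_ideal v2_ideal v12_neq X HX HL) as (s & Hs & ->).
  assert (E := sinh_dprime_chord_pt s Hs).
  assert (Hm := mink_ideal_pos v1 v2 v1_ideal v2_ideal v12_neq).
  generalize (pow2_ge_0 ((1 - s) * mink Rv v1 - s * mink Rv v2)); intro Hsq.
  apply Rminus_le_0, Rmult_le_reg_l with (2 * (s * (1 - s))); [nra|].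
  rewrite E, Rmult_0_r; nra.
Qed.

Lemma sinh_dprime_foot : exists X, in_D X /\ on_line v1 v2 X /\
  mink v1 v2 ^ 2 * mink Rv Rv * sinh (dprime Rv X) ^ 2 = cross v1 v2 Rv ^ 2.
Proof.
  assert (Hmink1 := mink_on_S1_pos Rv v1 HR v1_ideal).
  assert (Hmink2 := mink_on_S1_pos Rv v2 HR v2_ideal).
  set (s := mink Rv v1 / (mink Rv v1 + mink Rv v2)).
  assert (Hs : 0 < s < 1).
  { split; [apply Rdiv_lt_0_compat; lra|].
    apply Rmult_lt_reg_r with (mink Rv v1 + mink Rv v2); [lra|].
    unfold s, Rdiv; rewrite Rmult_assoc, Rinv_l by lra; lra. }
  exists (line_pt v1 v2 s); split; [now apply chord_pt_in_D_iff | split].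
  - apply on_line_iff; eauto.
  - assert (E := sinh_dprime_chord_pt s Hs).
    replace ((1 - s) * mink Rv v1 - s * mink Rv v2) with 0 in E
      by (unfold s; field; lra).
    apply Rminus_diag_uniq, Rmult_eq_reg_l with (2 * (s * (1 - s))); [| nra].
    rewrite E; ring.
Qed.

End DistanceToChord.

Lemma delta_eq_of_is_delta P Q Rv m : is_delta P Q Rv m -> delta P Q Rv = m.
Proof.
  intro Hm; apply epsilon_unique; [exact Hm|].
  destruct Hm as [(X & DX & LX & <-) HX]; intros n [(Y & DY & LY & <-) HY].
  apply Rle_antisym; auto.
Qed.

Lemma delta_attained_at_foot P Q Rv v1 v2 : in_D P -> in_D Q -> in_D Rv -> P <> Q ->
  chord_through P Q v1 v2 ->
  exists X, in_D X /\ delta P Q Rv = dprime Rv X /\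
    mink v1 v2 ^ 2 * mink Rv Rv * sinh (dprime Rv X) ^ 2 = cross v1 v2 Rv ^ 2.
Proof.
  intros HP HQ HR Hne (S1 & S2 & Hv & LP & LQ).
  assert (Hline : forall X, on_line P Q X <-> on_line v1 v2 X).
  { intro X; split; [| now apply on_line_common_line].
    apply on_line_common_line; trivial; apply (on_line_common_line v1 v2); trivial;
      unfold on_line, cross; ring. }
  destruct (sinh_dprime_foot v1 v2 Rv S1 S2 Hv HR) as (X & DX & LX & EX).
  exists X; split; [exact DX | split; [| exact EX]]; apply delta_eq_of_is_delta.
  split; [exists X; now rewrite Hline|]; intros Y DY LY; apply Hline in LY.
  assert (HXY := sinh_dprime_chord_ge v1 v2 Rv S1 S2 Hv HR Y DY LY).
  rewrite <- EX in HXY; apply Rmult_le_reg_l in HXY;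
    [| apply Rmult_lt_0_compat;
       [now apply pow_lt, mink_ideal_pos | now apply mink_diag_pos]].
  rewrite <- !Rsqr_pow2 in HXY; apply sinh_le_iff, Rsqr_incr_0_var; trivial.
  now apply sinh_nonneg, dprime_nonneg.
Qed.

Lemma delta_nonneg P Q Rv :
  in_D P -> in_D Q -> in_D Rv -> P <> Q -> 0 <= delta P Q Rv.
Proof.
  intros HP HQ HR Hne.
  destruct (chord_through_exists P Q HP HQ) as (v1 & v2 & Hchord).
  destruct (delta_attained_at_foot P Q Rv v1 v2 HP HQ HR Hne Hchord)
    as (X & HX & -> & _).
  now apply dprime_nonneg.
Qed.

Lemma sinh_dprime_sinh_delta P Q Rv : in_D P -> in_D Q -> in_D Rv -> P <> Q ->
  mink P P * mink Q Q * mink Rv Rv * (sinh (dprime P Q) * sinh (delta P Q Rv)) ^ 2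
  = cross P Q Rv ^ 2.
Proof.
  intros HP HQ HR Hne.
  destruct (chord_through_exists P Q HP HQ) as (v1 & v2 & Hchord).
  destruct (delta_attained_at_foot P Q Rv v1 v2 HP HQ HR Hne Hchord)
    as (X & _ & -> & EX).
  assert (Ed := sinh_dprime_sqr P Q HP HQ).
  destruct Hchord as (S1 & S2 & Hv & LP & LQ).
  apply on_line_iff in LP as [p EP], LQ as [q EQ]; trivial.
  transitivity (mink P P * mink Q Q * sinh (dprime P Q) ^ 2
                * (mink Rv Rv * sinh (dprime Rv X) ^ 2)); [ring|].
  rewrite Ed, EP, EQ, mink_gram_line_pt, cross_line_pt.
  rewrite Rpow_mult_distr, <- EX, (mink_on_S1 v1 S1); ring.
Qed.

Lemma delta_ge_Deltaprime_iff P Q Rv : in_D P -> in_D Q -> in_D Rv -> P <> Q ->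
  delta P Q Rv >= Deltaprime P Q <->
  mink P P * mink Q Q * mink Rv Rv <= cross P Q Rv ^ 2.
Proof.
  intros HP HQ HR Hne.
  assert (Hd := dprime_pos P Q HP HQ Hne).
  assert (ED : sinh (Deltaprime P Q) * sinh (dprime P Q) = 1)
    by now apply sinh_mul_sinh_ln_coth_half.
  assert (Hdelta := delta_nonneg P Q Rv HP HQ HR Hne).
  rewrite <- (sinh_dprime_sinh_delta P Q Rv HP HQ HR Hne).
  apply mink_diag_pos in HP, HQ, HR.
  set (m := mink P P * mink Q Q * mink Rv Rv).
  assert (Hm : 0 < m) by (repeat apply Rmult_lt_0_compat; assumption).
  apply sinh_nonneg in Hdelta; apply sinh_lt in Hd; rewrite sinh_0 in Hd.
  transitivity (1 <= sinh (dprime P Q) * sinh (delta P Q Rv)).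
  - transitivity (sinh (Deltaprime P Q) <= sinh (delta P Q Rv));
      [rewrite sinh_le_iff; lra | rewrite <- ED; split; intro H; nra].
  - assert (Hprod : 0 <= sinh (dprime P Q) * sinh (delta P Q Rv)) by nra.
    set (y := sinh (dprime P Q) * sinh (delta P Q Rv)) in *; split; intro H.
    + assert (1 <= y ^ 2) by nra; nra.
    + apply Rnot_lt_le; intro Hlt; assert (y ^ 2 < 1) by nra; nra.
Qed.

Theorem theorem4p2 (P Q Rv : pt) :
  nondegenerate P Q Rv ->
  (forall X, in_triangle P Q Rv X -> in_D X) ->
  (delta P Q Rv < Deltaprime P Q -> 1 / 3 < rho P Q Rv < 1 / 2) /\
  (delta P Q Rv >= Deltaprime P Q -> rho P Q Rv = 1 / 3).
Proof.
  intros Hnd HD; destruct (in_triangle_vertices P Q Rv) as (VP & VQ & VR).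
  apply HD in VP, VQ, VR.
  assert (Hne : P <> Q) by (intros ->; apply Hnd; unfold cross; ring).
  assert (Hiff : delta P Q Rv >= Deltaprime P Q <-> has_ideal_circumtriangle P Q Rv)
    by now rewrite delta_ge_Deltaprime_iff, has_ideal_circumtriangle_iff.
  split; intro H.
  - apply rho_between; trivial; rewrite <- Hiff; lra.
  - apply rho_eq_third; trivial; now apply Hiff.
Qed.
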